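(* Let $V$ be a finite set of variables and let $\mathcal{B}$ be a Sperner family of nonempty proper subsets of $V$ with $\bigcup_{B\in\mathcal{B}}B=V$ and $\bigcap_{B\in\mathcal{B}}B=\emptyset$. Let $E'$ be the arc set of a Hamiltonian cycle in the body graph $D_{\mathcal{B}}$, and let $\Phi_{E'}=\bigwedge_{(B,B')\in E'}B\rightarrow(B'\setminus B)$. Then $\Phi_{E'}$ represents $h_{\mathcal{B}}$ and $|\Phi_{E'}|_{TA}\le 2\,OPT_{TA}(\mathcal{B})$.
   Context: A pure Horn clause $B\rightarrow v$, with $\emptyset\neq B\subseteq V$ and $v\in V\setminus B$, is the clause $v\vee\bigvee_{u\in B}\overline{u}$. For $H\subseteq V\setminus B$, $B\rightarrow H$ abbreviates $\bigwedge_{v\in H}B\rightarrow v$. A pure Horn CNF grouped by bodies is written $\Phi=\bigwedge_{i=1}^{r}B_i\rightarrow H_i$ with distinct bodies $B_i$ and nonempty $H_i$; its total area is $|\Phi|_{TA}=\sum_i(|B_i|+|H_i|)$. For a family $\mathcal{B}$ of nonempty proper subsets of $V$, the key Horn function $h_{\mathcal{B}}$ is the Boolean function represented by $\bigwedge_{B\in\mathcal{B}}B\rightarrow(V\setminus B)$; a representation of $h_{\mathcal{B}}$ is any pure Horn CNF equivalent to it, and $OPT_{TA}(\mathcal{B})$ is the minimum total area of a representation. The body graph $D_{\mathcal{B}}$ is the complete directed graph with node set $\mathcal{B}$ and arc set $\mathcal{B}\times\mathcal{B}$. Sperner means no member of $\mathcal{B}$ is a proper subset of another. *)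

(* Defs.v *)
(* MathComp. *)
From mathcomp Require Import all_boot.

Set Implicit Arguments.
Unset Strict Implicit.
Unset Printing Implicit Defensive.

(* The pair (B, v) stands for the clause B -> v, and a CNF is the set of its
   clauses; since CNFs are sets, the decomposition by distinct bodies with
   nonempty head sets is canonical, see [bodies] and [heads]. *)
Definition clause (V : finType) := ({set V} * V)%type.
Definition cnf (V : finType) := {set clause V}.
Definition boolfun (V : finType) := {ffun V -> bool} -> bool.

Section PureHorn.
Variable V : finType.
Implicit Types (c : clause V) (B H : {set V}) (Phi : cnf V) (f : boolfun V).
Implicit Types (a : {ffun V -> bool}) (F : {set {set V}}).
Implicit Types (E : {set {set V} * {set V}}).

Definition pure_horn_clause c : bool := (c.1 != set0) && (c.2 \notin c.1).

Definition clause_eval c a : bool := a c.2 || [exists u in c.1, ~~ a u].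

Definition pure_horn Phi : bool := [forall c in Phi, pure_horn_clause c].

Definition cnf_eval Phi : boolfun V :=
  fun a => [forall c in Phi, clause_eval c a].

Definition implies B H : cnf V := [set (B, v) | v in H].

Definition bodies Phi : {set {set V}} := [set c.1 | c in Phi].

Definition heads Phi B : {set V} := [set v | (B, v) \in Phi].

Definition total_area Phi : nat :=
  \sum_(B in bodies Phi) (#|B| + #|heads Phi B|).

Definition represents Phi f : bool :=
  pure_horn Phi && [forall a, cnf_eval Phi a == f a].

Definition key_cnf F : cnf V := \bigcup_(B in F) implies B (~: B).

Definition key_horn F : boolfun V := cnf_eval (key_cnf F).

Definition OPT_TA F : nat :=
  total_area [arg min_(Phi < key_cnf F | represents Phi (key_horn F))
                total_area Phi].

Definition sperner F : Prop :=
  forall X Y, X \in F -> Y \in F -> ~~ (X \proper Y).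

(* The arc set is all of F x F, loops included. *)
Definition body_graph F : rel {set V} := [rel X Y | (X \in F) && (Y \in F)].

Definition hamiltonian_cycle F E : Prop :=
  exists s : seq {set V},
    [/\ ucycle (body_graph F) s, s =i F & E = [set (X, next s X) | X in s]].

Definition arcs_cnf E : cnf V := \bigcup_(e in E) implies e.1 (e.2 :\: e.1).

Lemma key_cnf_represents F :
  set0 \notin F -> represents (key_cnf F) (key_horn F).
Proof.
move=> F0; apply/andP; split; last by apply/forallP.
apply/forall_inP => c /bigcupP[B BF /imsetP[v vB ->]].
rewrite inE in vB; rewrite /pure_horn_clause /= vB andbT.
by apply: contraNneq F0 => <-.
Qed.

(* The default point of the arg min is a representation as soon as F consists
   of nonempty sets, and OPT_TA is then an attained minimum. *)
Lemma OPT_TA_minimum F : set0 \notin F ->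
  (exists2 Phi, represents Phi (key_horn F) & total_area Phi = OPT_TA F) /\
  (forall Phi, represents Phi (key_horn F) -> OPT_TA F <= total_area Phi).
Proof.
move=> F0; rewrite /OPT_TA.
case: arg_minnP => [|Phi repPhi minPhi]; first exact: key_cnf_represents.
by split; first exists Phi.
Qed.

End PureHorn.

(* Main.v *)
(* Along the Hamiltonian cycle, an assignment that makes one body true makes all
   bodies true, hence all of V since the bodies cover V; so the arcs represent
   h_B.  For the area, each representation has every member of B as a body: the
   characteristic vector of B violates some clause C -> v with C contained in B,
   and C -> v being an implicate forces C to contain a member of B, which is B
   itself because B is Sperner.  Thus the sum of the body sizes is at most OPT,
   while the cycle costs at most that sum for the bodies and again for the
   heads, as each set is the successor of exactly one body. *)
Require Import Defs.
From mathcomp Require Import all_boot.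

Set Implicit Arguments.
Unset Strict Implicit.
Unset Printing Implicit Defensive.

Section KeyHorn.
Variable V : finType.
Implicit Types (v : V) (B C D : {set V}) (Phi : cnf V) (F : {set {set V}}).
Implicit Types (a : {ffun V -> bool}) (s : seq {set V}).

Definition true_set a : {set V} := [set u | a u].

Definition char_fun B : {ffun V -> bool} := [ffun u => u \in B].

Lemma char_funK B : true_set (char_fun B) = B.
Proof. by apply/setP => u; rewrite inE ffunE. Qed.

(** Trading an assignment for its set of true variables lets all later arguments about models run on
    set inclusions. *)
Lemma clause_evalE (c : clause V) a :
  clause_eval c a = (c.1 \subset true_set a) ==> (c.2 \in true_set a).
Proof.
rewrite /clause_eval inE implybE orbC; congr (_ || _).
apply/exists_inP/subsetPn => -[u uc au]; exists u => //.
  by rewrite inE.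
by rewrite inE in au.
Qed.

Lemma cnf_evalP Phi a :
  reflect (forall B v, (B, v) \in Phi -> B \subset true_set a ->
             v \in true_set a)
          (cnf_eval Phi a).
Proof.
apply: (iffP forall_inP) => [sat B v /sat|sat [B v] /sat imp].
  by rewrite clause_evalE => /implyP.
by rewrite clause_evalE; apply/implyP.
Qed.

Lemma mem_implies B C D v : ((D, v) \in Defs.implies B C) = (D == B) && (v \in C).
Proof.
apply/imsetP/andP => [[w wC [-> ->]]|[/eqP-> vC]] //.
by exists v.
Qed.

Lemma mem_key_cnf F B v : ((B, v) \in key_cnf F) = (B \in F) && (v \notin B).
Proof.
apply/bigcupP/andP => [[C CF]|[BF vB]].
  by rewrite mem_implies => /andP[/eqP->]; rewrite inE.
by exists B; rewrite // mem_implies eqxx inE.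
Qed.

Lemma key_hornP F a :
  reflect (forall B, B \in F -> B \subset true_set a -> true_set a = setT)
          (key_horn F a).
Proof.
apply: (iffP (cnf_evalP _ _)) => sat B.
  move=> BF Ba; apply/setP => v; rewrite in_setT.
  have [/(subsetP Ba)//|vB] := boolP (v \in B).
  by apply: sat Ba; rewrite mem_key_cnf BF.
by move=> v; rewrite mem_key_cnf => /andP[BF _] /(sat B BF) ->; rewrite inE.
Qed.

Lemma sub_bodies_of_represents F Phi :
    sperner F -> (forall B, B \in F -> B \proper setT) ->
  represents Phi (key_horn F) -> F \subset bodies Phi.
Proof.
move=> spF prF /andP[_ /forallP repPhi]; apply/subsetP => B BF.
have: ~~ cnf_eval Phi (char_fun B).
  rewrite (eqP (repPhi _)); apply/key_hornP => /(_ B BF).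
  rewrite char_funK => /(_ (subxx _)) BT.
  by have := prF B BF; rewrite BT properxx.
case/forall_inPn => -[C v] Cv; rewrite clause_evalE negb_imply char_funK /=.
case/andP=> CB vB.
have vC : v \notin C by apply: contra vB; apply: subsetP.
(* The characteristic vector of [C] falsifies [C -> v] itself, hence [Phi], hence the key function,
   which can only fail at a point whose true set contains a member of [F]. *)
have: ~~ key_horn F (char_fun C).
  rewrite -(eqP (repPhi _)); apply/cnf_evalP => /(_ C v Cv).
  by rewrite char_funK => /(_ (subxx _)); apply/negP.
have [/exists_inP[B' B'F B'C] _|noB] := boolP [exists B' in F, B' \subset C].
  (* The chain [B' \subset C \subset B] collapses by the Sperner property, so the body [C] of [Phi]
     is [B]. *)
  have /eqP eqB : B' == B.
    rewrite eqEproper (subset_trans B'C CB) /=; exact: spF.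
  have -> : B = C by apply/eqP; rewrite eqEsubset CB -eqB B'C.
  by apply/imsetP; exists (C, v).
case/key_hornP => B' B'F; rewrite char_funK => B'C.
by case/exists_inP: noB; exists B'.
Qed.

Lemma sum_card_le_OPT_TA F :
    sperner F -> (forall B, B \in F -> B \proper setT) -> set0 \notin F ->
  \sum_(B in F) #|B| <= OPT_TA F.
Proof.
move=> spF prF /OPT_TA_minimum[[Phi repPhi <-] _].
have subF := sub_bodies_of_represents spF prF repPhi.
(* Bodies of [Phi] outside [F] and all head sets are discarded from the optimum. *)
rewrite /total_area [leqRHS](big_setID F) /= (setIidPr subF).
by apply: leq_trans (leq_addr _ _); apply: leq_sum => B _; apply: leq_addr.
Qed.

Lemma mem_arcs_cnf_next s B v :
  ((B, v) \in arcs_cnf [set (X, next s X) | X in s]) =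
  [&& B \in s, v \notin B & v \in next s B].
Proof.
apply/bigcupP/and3P => [[_ /imsetP[X Xs ->]]|[Bs vB vN]].
  by rewrite mem_implies => /andP[/eqP->]; rewrite inE => /andP[].
exists (B, next s B); first by apply/imsetP; exists B.
by rewrite mem_implies eqxx inE vB.
Qed.

Lemma arcs_cnf_next_represents F s :
    set0 \notin F -> \bigcup_(B in F) B = setT -> uniq s -> s =i F ->
  represents (arcs_cnf [set (X, next s X) | X in s]) (key_horn F).
Proof.
move=> F0 covF us sF; apply/andP; split.
  apply/forall_inP => -[B v]; rewrite mem_arcs_cnf_next sF => /and3P[BF vB _].
  by rewrite /pure_horn_clause vB andbT; apply: contraNneq F0 => <-.
apply/forallP => a; apply/eqP; apply/cnf_evalP/key_hornP => sat B; last first.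
  move=> v; rewrite mem_arcs_cnf_next sF => /and3P[BF _ _] /(sat B BF) ->.
  by rewrite inE.
move=> BF Ba; apply/eqP; rewrite -subTset -covF; apply/bigcupsP => C CF.
(* Truth passes along one arc: variables of [next s D] already in [D] are true, and the others are
   heads of [D]. *)
have step D : D \in s /\ D \subset true_set a ->
    next s D \in s /\ next s D \subset true_set a.
  case=> Ds Da; rewrite mem_next; split=> //; apply/subsetP => v vN.
  have [/(subsetP Da)//|vD] := boolP (v \in D).
  by apply: sat Da; rewrite mem_arcs_cnf_next Ds vD.
(* Every node of a cycle is reached from any other by iterating [next s]; [findex] supplies the
   number of steps. *)
have BC : fconnect (next s) B C.
  by rewrite (fconnect_cycle (cycle_next us)) sF.
rewrite -(iter_findex BC); set n := findex _ _ _.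
suff [] : iter n (next s) B \in s /\ iter n (next s) B \subset true_set a by [].
by elim: n => [|n IHn]; [rewrite sF | apply: step].
Qed.

Lemma total_area_arcs_cnf_next F s :
    uniq s -> s =i F ->
  total_area (arcs_cnf [set (X, next s X) | X in s]) <= 2 * \sum_(B in F) #|B|.
Proof.
move=> us sF; set Phi := arcs_cnf _.
(* Only an inclusion: [B] yields no clause when its successor lies inside [B]. *)
have subF : bodies Phi \subset F.
  apply/subsetP => _ /imsetP[[B v] + ->].
  by rewrite mem_arcs_cnf_next sF => /and3P[].
(* [next s] is injective and preserves membership in [F], so it permutes [F]. *)
have sum_next : \sum_(B in F) #|next s B| = \sum_(B in F) #|B|.
  rewrite [RHS](reindex_inj (can_inj (prev_next us))) /=.
  by apply: eq_bigl => B; rewrite -!sF mem_next.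
rewrite mul2n -addnn -[X in _ + X]sum_next -big_split /=.
rewrite [leqRHS](big_setID (bodies Phi)) /= (setIidPr subF).
apply: leq_trans (leq_addr _ _); apply: leq_sum => B _.
rewrite leq_add2l; apply/subset_leq_card/subsetP => v.
by rewrite inE mem_arcs_cnf_next => /and3P[].
Qed.

End KeyHorn.

Theorem theorem1 (V : finType) (F : {set {set V}})
    (E' : {set {set V} * {set V}})
    (F_nonempty_proper : forall B, B \in F -> B != set0 /\ B \proper [set: V])
    (F_sperner : sperner F)
    (F_cover : \bigcup_(B in F) B = [set: V])
    (F_inter : \bigcap_(B in F) B = set0)
    (E'_ham : hamiltonian_cycle F E') :
  represents (arcs_cnf E') (key_horn F)
  /\ total_area (arcs_cnf E') <= 2 * OPT_TA F.
Proof.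
have F0 : set0 \notin F by apply/negP => /F_nonempty_proper[/eqP].
case: E'_ham => s [/andP[_ us] sF ->].
split; first exact: arcs_cnf_next_represents.
apply: leq_trans (total_area_arcs_cnf_next us sF) _.
rewrite leq_mul2l sum_card_le_OPT_TA // => B.
by case/F_nonempty_proper.
Qed.
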